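(* Let $\mathbf{x}=\begin{pmatrix}\bar{\mathbf{x}}\\ x_d\end{pmatrix}\in\mathbb{R}^d$ be a data point whose first $d-1$ entries $\bar{\mathbf{x}}$ are observed and whose last entry $x_d$ is missing, and let $\mathbf{W}=\begin{pmatrix}\overline{\mathbf{W}}\\ \mathbf{W}_d\end{pmatrix}\in\mathbb{R}^{d\times r}$, where $\overline{\mathbf{W}}$ consists of the first $d-1$ rows of $\mathbf{W}$ and $\mathbf{W}_d$ is its last row. Here $\bar{\mathbf{x}}$, $\mathbf{W}$ and the coefficient vector $\mathbf{h}\in\mathbb{R}^r$ are entrywise non-negative, and $\bar{\mathbf{x}}$ and $\mathbf{W}$ are held fixed. Then the squared error $$\tfrac12\|\mathbf{x}-\mathbf{W}\mathbf{h}\|^2$$ is non-increasing under the following updates of $x_d$ and $\mathbf{h}$: $$x_d^{n+1}=\mathbf{W}_d\mathbf{h}_n,\qquad \mathbf{h}_{n+1}=\mathbf{h}_n\circ\frac{\overline{\mathbf{W}}^T\bar{\mathbf{x}}}{\overline{\mathbf{W}}^T\overline{\mathbf{W}}\mathbf{h}_n}.$$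
   Context: The setting is non-negative matrix factorization with a missing attribute. A non-negative matrix $\mathbf{W}\in\mathbb{R}^{d\times r}$ of basis vectors has been learned from training data and is kept fixed. For a test point $\mathbf{x}\in\mathbb{R}^d$ whose last coordinate $x_d$ is missing (without loss of generality), one seeks a value $x_d$ and a non-negative vector $\mathbf{h}\in\mathbb{R}^r$ such that $\mathbf{x}\approx\mathbf{W}\mathbf{h}$. The index $n$ denotes the iteration number: $x_d^n$ and $\mathbf{h}_n$ are the values of $x_d$ and $\mathbf{h}$ at iteration $n$. The symbol $\circ$ denotes the entrywise product of vectors, the fraction of two vectors denotes entrywise division, and $\|\cdot\|$ is the Euclidean norm.
   Formalization: The error after an update of h is measured with x_d refreshed from the new h, i.e. the error at (x_d^{n+2}, h_{n+1}) is at most that at (x_d^{n+1}, h_n), which is at most that at (x_d^n, h_n); comparing (x_d^{n+1}, h_{n+1}) with (x_d^n, h_n) can fail. *)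

(* Defs.v *)
From HB Require Import structures.
From mathcomp Require Import all_boot all_order all_algebra.
From mathcomp Require Import reals.

Set Implicit Arguments.
Unset Strict Implicit.
Unset Printing Implicit Defensive.

Import Order.TTheory GRing.Theory Num.Theory.
Local Open Scope ring_scope.

(* The norm that the analysis library puts on matrices is the sup norm, hence
   this Euclidean one. *)
Definition enorm (R : realType) (k : nat) (v : 'cV[R]_k) : R :=
  Num.sqrt (\sum_i v i 0 ^+ 2).

Definition sqerr (R : realType) (d r : nat)
    (x : 'cV[R]_d) (W : 'M[R]_(d, r)) (h : 'cV[R]_r) : R :=
  2^-1 * enorm (x - W *m h) ^+ 2.

Definition emul (R : realType) (k : nat) (u v : 'cV[R]_k) : 'cV[R]_k :=
  map2_mx (fun a b => a * b) u v.

(* Division is total, with a / 0 = 0.  In the multiplicative update below, a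
   zero denominator at index a forces h_a = 0 or a zero a-th column of Wbar, so
   Wbar *m h does not depend on the value chosen for this quotient. *)
Definition ediv (R : realType) (k : nat) (u v : 'cV[R]_k) : 'cV[R]_k :=
  map2_mx (fun a b => a / b) u v.

Definition h_update (R : realType) (m r : nat)
    (xbar : 'cV[R]_m) (Wbar : 'M[R]_(m, r)) (h : 'cV[R]_r) : 'cV[R]_r :=
  emul h (ediv (Wbar^T *m xbar) (Wbar^T *m Wbar *m h)).

(* The data point (xbar, t) of dimension d = m + 1. *)
Definition complete (R : realType) (m : nat) (xbar : 'cV[R]_m) (t : R)
    : 'cV[R]_(m + 1) :=
  col_mx xbar t%:M.

(* Main.v *)
(* Setting the last coordinate to its prediction kills the last residual, so only
   the error on the observed rows remains.  For that error the update of h is the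
   Lee-Seung one: writing h' = h + h o e, Jensen's inequality in each row gives
   |Wbar (h o e)|^2 <= sum_a h_a (Wbar^T Wbar h)_a e_a^2, and the update is the
   choice of e for which the right-hand side equals the first-order decrease
   sum_a h_a e_a (Wbar^T (xbar - Wbar h))_a. *)
Require Import Defs.
From HB Require Import structures.
From mathcomp Require Import all_boot all_order all_algebra.
From mathcomp Require Import reals.
From mathcomp Require Import ring lra.

Set Implicit Arguments.
Unset Strict Implicit.
Unset Printing Implicit Defensive.

Import Order.TTheory GRing.Theory Num.Theory.
Local Open Scope ring_scope.


(** Lagrange's identity: the gap between the two sides is half of the sum of
    [w a * w b * (e a - e b) ^+ 2] over all pairs. The weights need not add up to 1, whence the
    factor [\sum_a w a]. *)
Lemma jensen_sqr_sum (R : realFieldType) (I : finType) (w e : I -> R) :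
  (forall a, 0 <= w a) ->
  (\sum_a w a * e a) ^+ 2 <= (\sum_a w a) * (\sum_a w a * e a ^+ 2).
Proof.
move=> w_ge0; pose D := \sum_a \sum_b w a * w b * (e a - e b) ^+ 2.
have D_ge0 : 0 <= D.
  apply: sumr_ge0 => a _; apply: sumr_ge0 => b _.
  by rewrite mulr_ge0 ?sqr_ge0 // mulr_ge0.
have swap (f g : I -> R) :
    (\sum_a f a) * (\sum_b g b) = \sum_a \sum_b f a * g b.
  by rewrite mulr_suml; apply: eq_bigr => a _; rewrite mulr_sumr.
suff DE : D = 2 * ((\sum_a w a) * (\sum_a w a * e a ^+ 2)
                   - (\sum_a w a * e a) ^+ 2).
  by move: D_ge0; rewrite DE pmulr_rge0 // subr_ge0.
rewrite mulr_natl mulr2n -{1}[(\sum_a w a) * _]mulrC expr2 !swap.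
rewrite -!sumrB -big_split /=; apply: eq_bigr => a _.
by rewrite -!sumrB -big_split /=; apply: eq_bigr => b _; ring.
Qed.

Lemma mxOver_nneg_ge0 (R : realType) (m n : nat) (A : 'M[R]_(m, n)) i j :
  A \is a mxOver Num.nneg -> 0 <= A i j.
Proof. by move/mxOverP/(_ i j); rewrite nnegrE. Qed.

Lemma gram_mulmxE (R : realType) (m r : nat) (B : 'M[R]_(m, r)) (h : 'cV[R]_r) a :
  (B^T *m B *m h) a 0 = \sum_i B i a * (B *m h) i 0.
Proof. by rewrite -mulmxA mxE; apply: eq_bigr => i _; rewrite mxE. Qed.

Lemma h_updateE (R : realType) (m r : nat) (x : 'cV[R]_m) (B : 'M[R]_(m, r))
    (h : 'cV[R]_r) a :
  h_update x B h a 0 = h a 0 * ((B^T *m x) a 0 / (B^T *m B *m h) a 0).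
Proof. by rewrite !mxE. Qed.

Lemma h_update_ge0 (R : realType) (m r : nat) (x : 'cV[R]_m) (B : 'M[R]_(m, r))
    (h : 'cV[R]_r) :
  x \is a mxOver Num.nneg -> B \is a mxOver Num.nneg ->
  h \is a mxOver Num.nneg -> h_update x B h \is a mxOver Num.nneg.
Proof.
move=> x_ge0 B_ge0 h_ge0; have BT_ge0 : B^T \is a mxOver Num.nneg.
  by apply/mxOverP => i j; rewrite mxE; apply: (mxOverP B_ge0).
apply/mxOverP => a j; rewrite ord1 nnegrE h_updateE.
by rewrite mulr_ge0 ?divr_ge0 // mxOver_nneg_ge0 // ?mxOverM // mxOverM.
Qed.

Lemma sqerrE (R : realType) (d r : nat) (x : 'cV[R]_d) (W : 'M[R]_(d, r))
    (h : 'cV[R]_r) :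
  sqerr x W h = 2^-1 * \sum_i (x i 0 - (W *m h) i 0) ^+ 2.
Proof.
rewrite /sqerr /enorm sqr_sqrtr; last by apply: sumr_ge0 => i _; rewrite sqr_ge0.
by congr (_ * _); apply: eq_bigr => i _; rewrite [in LHS]mxE [X in _ + X]mxE.
Qed.

Lemma sqerr_complete (R : realType) (m r : nat) (x : 'cV[R]_m) (t : R)
    (B : 'M[R]_(m, r)) (v : 'rV[R]_r) (h : 'cV[R]_r) :
  sqerr (complete x t) (col_mx B v) h =
    sqerr x B h + 2^-1 * (t - (v *m h) 0 0) ^+ 2.
Proof.
rewrite !sqerrE big_split_ord /= big_ord1 mulrDr mul_col_mx /complete.
congr (_ * _ + _ * _); first by apply: eq_bigr => i _; rewrite !col_mxEu.
by rewrite !col_mxEd [t%:M _ _]mxE eqxx mulr1n.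
Qed.

(** When [q] is nonzero, [c - q] is [(c / q - 1) * q]. Non-negativity serves the case [q = 0], where
    the quotient takes its default value 0. *)
Lemma h_update_first_order (R : realType) (m r : nat) (x : 'cV[R]_m)
    (B : 'M[R]_(m, r)) (h : 'cV[R]_r) a :
  let q := (B^T *m B *m h) a 0 in let c := (B^T *m x) a 0 in
  B \is a mxOver Num.nneg -> h \is a mxOver Num.nneg ->
  h a 0 * (c / q - 1) * (c - q) = h a 0 * (c / q - 1) ^+ 2 * q.
Proof.
move=> q c B_ge0 h_ge0.
have [q0|q_neq0] := eqVneq q 0; last by field.
(* c / 0 = 0: it remains to see that h_a c_a = 0. *)
suff hc0 : h a 0 * c = 0 by rewrite q0 invr0 mulr0 subr0 mulr0 mulrAC hc0 mul0r.
have [->|h_neq0] := eqVneq (h a 0) 0; first by rewrite mul0r.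
have Bh_ge0 i : 0 <= B i a * (B *m h) i 0.
  by rewrite mulr_ge0 // mxOver_nneg_ge0 // mxOverM.
suff B0 i : B i a = 0.
  by rewrite [c]mxE big1 ?mulr0 // => i _; rewrite mxE B0 mul0r.
(* A vanishing sum of non-negative terms: for each [i], either [B i a = 0] or [(B *m h) i 0 = 0].
   The latter is again such a sum, so [B i a * h a 0 = 0] with [h a 0] nonzero. *)
move: q0; rewrite /q gram_mulmxE => /psumr_eq0P-/(_ (fun i _ => Bh_ge0 i) i isT).
move/eqP; rewrite mulf_eq0 => /orP[/eqP//|/eqP].
rewrite mxE => /psumr_eq0P H.
have /eqP := H (fun b _ => mulr_ge0 (mxOver_nneg_ge0 i b B_ge0)
  (mxOver_nneg_ge0 b 0 h_ge0)) a isT.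
by rewrite mulf_eq0 (negPf h_neq0) orbF => /eqP.
Qed.

Lemma sqerr_h_update (R : realType) (m r : nat) (x : 'cV[R]_m)
    (B : 'M[R]_(m, r)) (h : 'cV[R]_r) :
  B \is a mxOver Num.nneg -> h \is a mxOver Num.nneg ->
  sqerr x B (h_update x B h) <= sqerr x B h.
Proof.
move=> B_ge0 h_ge0; pose c a := (B^T *m x) a 0; pose q a := (B^T *m B *m h) a 0.
pose e a := c a / q a - 1; pose p i := (B *m h) i 0.
pose s i := \sum_a B i a * h a 0 * e a.
have BhE i : (B *m h_update x B h) i 0 = p i + s i.
  rewrite /p !mxE -big_split /=; apply: eq_bigr => a _.
  by rewrite h_updateE /e /c /q; ring.
(* Jensen in row [i] with weights [B i a * h a 0], whose total is [p i]; after exchanging the sums,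
   the [B i a * p i] add up to [q a]. *)
have s_sqr_le : \sum_i s i ^+ 2 <= \sum_a h a 0 * e a ^+ 2 * q a.
  apply: (@le_trans _ _ (\sum_i p i * \sum_a B i a * h a 0 * e a ^+ 2)).
    apply: ler_sum => i _; rewrite [p i]mxE; apply: jensen_sqr_sum => a.
    by rewrite mulr_ge0 // mxOver_nneg_ge0.
  under eq_bigr do rewrite mulr_sumr.
  rewrite exchange_big /=; apply: ler_sum => a _.
  rewrite /q gram_mulmxE mulr_sumr; apply: ler_sum => i _.
  by rewrite le_eqVlt; apply/orP; left; apply/eqP; rewrite /p; ring.
have s_inner : \sum_i (x i 0 - p i) * s i = \sum_a h a 0 * e a ^+ 2 * q a.
  under eq_bigr do rewrite mulr_sumr.
  rewrite exchange_big /=; apply: eq_bigr => a _.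
  have -> : h a 0 * e a ^+ 2 * q a = h a 0 * e a * (c a - q a).
    by rewrite [RHS]h_update_first_order.
  rewrite [c a]mxE [q a]gram_mulmxE -sumrB.
  rewrite mulr_sumr; apply: eq_bigr => i _.
  by rewrite [B^T a i]mxE -/(p i); ring.
have s_sqr_ge0 : 0 <= \sum_i s i ^+ 2 by apply: sumr_ge0 => i _; rewrite sqr_ge0.
rewrite !sqerrE ler_pM2l ?invr_gt0 //.
have -> : \sum_i (x i 0 - (B *m h_update x B h) i 0) ^+ 2 =
    \sum_i (x i 0 - p i) ^+ 2 - 2 * (\sum_i (x i 0 - p i) * s i)
    + \sum_i s i ^+ 2.
  rewrite mulr_sumr -sumrB -big_split /=.
  by apply: eq_bigr => i _; rewrite BhE; ring.
(* With S the sum of the [s i ^+ 2] and Q the common bound, the error changes by a multiple of S -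
   2Q, and 0 <= S <= Q. *)
by rewrite s_inner; lra.
Qed.

(** The second inequality pairs [h n.+1] with the refreshed value [xd n.+2]: the update of [h]
    ignores the last row, so with [xd n.+1] kept the last residual could raise the error. The first
    inequality covers the update of [xd] alone, from an arbitrary [xd 0]. *)
Theorem theorem1 (R : realType) (m r : nat)
    (xbar : 'cV[R]_m) (Wbar : 'M[R]_(m, r)) (Wd : 'rV[R]_r)
    (xd : nat -> R) (h : nat -> 'cV[R]_r)
    (xbar_ge0 : xbar \is a mxOver Num.nneg)
    (W_ge0 : col_mx Wbar Wd \is a mxOver Num.nneg)
    (h0_ge0 : h 0%N \is a mxOver Num.nneg)
    (xdS : forall n : nat, xd n.+1 = (Wd *m h n) 0 0)
    (hS : forall n : nat, h n.+1 = h_update xbar Wbar (h n)) :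
  forall n : nat,
    sqerr (complete xbar (xd n.+1)) (col_mx Wbar Wd) (h n)
      <= sqerr (complete xbar (xd n)) (col_mx Wbar Wd) (h n)
    /\ sqerr (complete xbar (xd n.+2)) (col_mx Wbar Wd) (h n.+1)
      <= sqerr (complete xbar (xd n.+1)) (col_mx Wbar Wd) (h n).
Proof.
have B_ge0 : Wbar \is a mxOver Num.nneg.
  apply/mxOverP => i a.
  by have /mxOverP/(_ (lshift 1 i) a) := W_ge0; rewrite col_mxEu.
have h_ge0 n : h n \is a mxOver Num.nneg.
  by elim: n => [//|n IHn]; rewrite hS h_update_ge0.
(* At each refreshed point the last residual is zero, which leaves the error on the observed
   rows. *)
move=> n; rewrite !sqerr_complete !xdS !subrr expr0n mulr0 !addr0; split.
  by rewrite lerDl mulr_ge0 ?invr_ge0 ?sqr_ge0.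
by rewrite hS sqerr_h_update.
Qed.
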